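(* Let $A$ be an integral domain, $M$ a PS $A$-module and $P$ a flat $A$-module. Then $M\otimes_A P$ is a PS module over $A$.
   Context: All rings are commutative and unitary. For an integral domain $A$, a torsion-free $A$-module $M$ is a PS module (pre-Schreier module) if every equality $ax=by$ with $a,b\in A-\{0\}$ and $x,y\in M-\{0\}$ has a refinement, i.e. there exist $c,d,e\in A$ and $z\in M$ with $a=ce$, $b=cd$, $x=dz$, $y=ez$. *)

(* Defs.v *)
From HB Require Import structures.
From mathcomp Require Import all_boot all_order all_algebra.
From mathcomp Require Import boolp.
From mathcomp Require Import freeg.

Set Implicit Arguments.
Unset Strict Implicit.
Unset Printing Implicit Defensive.

Import GRing.Theory.
Local Open Scope ring_scope.
Local Open Scope quotient_scope.

Section FreeModule.
Variables (R : nzRingType) (K : choiceType).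

Lemma freegU_scale (c k : R) (x : K) :
  c *: << k *g x >> = << (c * k) *g x >> :> {freeg K / R}.
Proof. by apply/eqP/freeg_eqP=> y; rewrite coeffZ !coeffU mulrA. Qed.

Variables (U : lmodType R) (f : K -> U).

Lemma fgliftD : {morph fglift f : u v / u + v}.
Proof.
have h := lift_is_additive f.
have h0 : fglift f 0 = 0 by rewrite -(subrr 0) h subrr.
have hN v : fglift f (- v) = - fglift f v by rewrite -sub0r h h0 sub0r.
by move=> u v; rewrite -[v in LHS]opprK h hN opprK.
Qed.

Lemma fglift_is_linear : linear (fglift f).
Proof.
have h0 : fglift f 0 = 0 by rewrite -(subrr 0) lift_is_additive subrr.
have hsum (s : seq K) (F : K -> {freeg K / R}) :
    fglift f (\sum_(x <- s) F x) = \sum_(x <- s) fglift f (F x).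
  by apply: (big_morph (fglift f) fgliftD h0).
move=> c u v; rewrite fgliftD; congr (_ + _).
rewrite -[in LHS](freeg_sumE u) -[in RHS](freeg_sumE u).
rewrite scaler_sumr !hsum scaler_sumr.
by apply: eq_bigr => x _; rewrite freegU_scale !liftU scalerA.
Qed.

HB.instance Definition _ :=
  GRing.isLinear.Build R {freeg K / R} U _ (fglift f) fglift_is_linear.

End FreeModule.

Section TensorProduct.
Variables (A : comNzRingType) (M P : lmodType A).

(* The submodule of the free module on M x P generated by the relations that
   make (m, p) bilinear. *)
Inductive tensor_rel : {freeg (M * P) / A} -> Prop :=
| TensorRelDl m m' p :
    tensor_rel (<< (m + m', p) >> - (<< (m, p) >> + << (m', p) >>))
| TensorRelDr m p p' :
    tensor_rel (<< (m, p + p') >> - (<< (m, p) >> + << (m, p') >>))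
| TensorRelZl a m p : tensor_rel (<< (a *: m, p) >> - a *: << (m, p) >>)
| TensorRelZr a m p : tensor_rel (<< (m, a *: p) >> - a *: << (m, p) >>)
| TensorRel0 : tensor_rel 0
| TensorRelP a u v : tensor_rel u -> tensor_rel v -> tensor_rel (a *: u + v).

Definition tensor_relb (u : {freeg (M * P) / A}) : bool := `[< tensor_rel u >].

Fact tensor_relb_zmod_closed : zmod_closed tensor_relb.
Proof.
split=> [|u v /asboolP hu /asboolP hv]; apply/asboolP; first exact: TensorRel0.
by rewrite addrC -scaleN1r; apply: TensorRelP.
Qed.

HB.instance Definition _ :=
  GRing.isZmodClosed.Build _ tensor_relb tensor_relb_zmod_closed.

Definition tensor : Type :=
  Quotient.quot (GRing.ZmodClosed.clone _ tensor_relb _).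

HB.instance Definition _ := GRing.Zmodule.on tensor.
HB.instance Definition _ := Quotient.on tensor.

Definition tensor_pi (u : {freeg (M * P) / A}) : tensor := \pi_tensor u.

Lemma tensor_piP u v : tensor_pi u = tensor_pi v <-> tensor_rel (u - v).
Proof.
have -> : tensor_rel (u - v) <-> u - v \in tensor_relb.
  by split=> [h|/asboolP//]; apply/asboolP.
by rewrite Quotient.idealrBE; split=> [h|/eqP//]; apply/eqP.
Qed.

Lemma tensor_piK x : tensor_pi (repr x) = x.
Proof. exact: reprK. Qed.

Lemma tensor_piD : {morph tensor_pi : u v / u + v}.
Proof. exact: (raddfD \pi_(Quotient.quot (GRing.ZmodClosed.clone _ tensor_relb _))). Qed.

Definition tensor_scale (a : A) (x : tensor) : tensor :=
  tensor_pi (a *: repr x).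

Lemma tensor_pi_scale a u : tensor_scale a (tensor_pi u) = tensor_pi (a *: u).
Proof.
apply/tensor_piP; rewrite -scalerBr -[_ *: _]addr0.
by apply: TensorRelP TensorRel0; apply/tensor_piP; rewrite tensor_piK.
Qed.

Fact tensor_scaleA a b x :
  tensor_scale a (tensor_scale b x) = tensor_scale (a * b) x.
Proof. by rewrite -[x]tensor_piK !tensor_pi_scale scalerA. Qed.

Fact tensor_scale1 : left_id 1 tensor_scale.
Proof. by move=> x; rewrite -[x]tensor_piK tensor_pi_scale scale1r. Qed.

Fact tensor_scaleDr : right_distributive tensor_scale +%R.
Proof.
move=> a x y; rewrite -[x]tensor_piK -[y]tensor_piK.
by rewrite -tensor_piD !tensor_pi_scale scalerDr tensor_piD.
Qed.

Fact tensor_scaleDl x : {morph tensor_scale^~ x : a b / a + b}.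
Proof.
by move=> a b; rewrite -[x]tensor_piK !tensor_pi_scale scalerDl tensor_piD.
Qed.

HB.instance Definition _ := GRing.Zmodule_isLmodule.Build A tensor
  tensor_scaleA tensor_scale1 tensor_scaleDr tensor_scaleDl.

Fact tensor_pi_is_linear : linear tensor_pi.
Proof. by move=> a u v; rewrite tensor_piD -tensor_pi_scale. Qed.

HB.instance Definition _ :=
  GRing.isLinear.Build A {freeg (M * P) / A} tensor _ tensor_pi
    tensor_pi_is_linear.

Definition tens (m : M) (p : P) : tensor := tensor_pi << (m, p) >>.

Fact tens_is_bilinear :
  bilinear_for
    (GRing.Scale.Law.clone _ _ *:%R _) (GRing.Scale.Law.clone _ _ *:%R _) tens.
Proof.
have Dl m m' p : tens (m + m') p = tens m p + tens m' p.
  by rewrite -tensor_piD; apply/tensor_piP; apply: TensorRelDl.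
have Dr m p p' : tens m (p + p') = tens m p + tens m p'.
  by rewrite -tensor_piD; apply/tensor_piP; apply: TensorRelDr.
have Zl a m p : tens (a *: m) p = a *: tens m p.
  by rewrite -linearZ; apply/tensor_piP; apply: TensorRelZl.
have Zr a m p : tens m (a *: p) = a *: tens m p.
  by rewrite -linearZ; apply/tensor_piP; apply: TensorRelZr.
by split=> z a x y /=; rewrite ?Dl ?Dr ?Zl ?Zr.
Qed.

HB.instance Definition _ :=
  bilinear_isBilinear.Build A M P tensor _ _ tens tens_is_bilinear.

Lemma tensor_ind (Q : tensor -> Prop) :
  (forall m p, Q (tens m p)) -> Q 0 ->
  (forall a x y, Q x -> Q y -> Q (a *: x + y)) -> forall x, Q x.
Proof.
move=> Qt Q0 QD x; rewrite -[x]tensor_piK -[repr x]freeg_sumE.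
elim: (dom _) => [|[m p] s IHs]; first by rewrite big_nil linear0.
rewrite big_cons -[coeff _ _]mulr1 -freegU_scale linearP.
by apply: QD => //; apply: Qt.
Qed.

(* Meaningful only for bilinear f, where it does not depend on the choice of
   representative (tensor_lift_pi). *)
Definition tensor_lift (U : lmodType A) (f : M -> P -> U) (x : tensor) : U :=
  fglift (fun mp => f mp.1 mp.2) (repr x).

Lemma tensor_lift_pi (U : lmodType A) (f : {bilinear M -> P -> U}) u :
  tensor_lift f (tensor_pi u) = fglift (fun mp => f mp.1 mp.2) u.
Proof.
rewrite /tensor_lift; set F := fglift _; apply/eqP; rewrite -subr_eq0 -linearB.
have h : tensor_rel (repr (tensor_pi u) - u) by apply/tensor_piP/tensor_piK.
apply/eqP; elim: h => [m m' p|m p p'|a m p|a m p||a v w _ hv _ hw].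
- by rewrite linearB linearD /= /F !liftU !scale1r linearDl subrr.
- by rewrite linearB linearD /= /F !liftU !scale1r linearDr subrr.
- by rewrite linearB linearZ /= /F !liftU !scale1r linearZl subrr.
- by rewrite linearB linearZ /= /F !liftU !scale1r linearZr subrr.
- by rewrite linear0.
- by rewrite linearP /= hv hw scaler0 addr0.
Qed.

Lemma tensor_lift_tens (U : lmodType A) (f : {bilinear M -> P -> U}) m p :
  tensor_lift f (tens m p) = f m p.
Proof. by rewrite tensor_lift_pi liftU scale1r. Qed.

Fact tensor_lift_is_linear (U : lmodType A) (f : {bilinear M -> P -> U}) :
  linear (tensor_lift f).
Proof.
move=> a x y; rewrite -[x]tensor_piK -[y]tensor_piK -linearP !tensor_lift_pi.
by rewrite linearP.
Qed.

HB.instance Definition _ (U : lmodType A) (f : {bilinear M -> P -> U}) :=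
  GRing.isLinear.Build A tensor U _ (tensor_lift f) (tensor_lift_is_linear f).

Lemma tensor_lift_unique (U : lmodType A) (g h : {linear tensor -> U}) :
  (forall m p, g (tens m p) = h (tens m p)) -> g =1 h.
Proof.
move=> gh; elim/tensor_ind=> [//||a x y hx hy]; first by rewrite !linear0.
by rewrite !linearP hx hy.
Qed.

End TensorProduct.

Section TensorMap.
Variables (A : comNzRingType) (M N P : lmodType A) (f : {linear M -> N}).

Definition tens_comp (m : M) (p : P) : tensor N P := tens (f m) p.

Fact tens_comp_is_bilinear :
  bilinear_for
    (GRing.Scale.Law.clone _ _ *:%R _) (GRing.Scale.Law.clone _ _ *:%R _)
    tens_comp.
Proof.
by split=> z a x y; rewrite /tens_comp ?linearP ?linearPl ?linearPr.
Qed.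

HB.instance Definition _ :=
  bilinear_isBilinear.Build A M P (tensor N P) _ _ tens_comp
    tens_comp_is_bilinear.

(* f tensored with the identity of P *)
Definition tensor_mapl : tensor M P -> tensor N P := tensor_lift tens_comp.

HB.instance Definition _ := GRing.Linear.on tensor_mapl.

Lemma tensor_mapl_tens m p : tensor_mapl (tens m p) = tens (f m) p.
Proof. exact: tensor_lift_tens. Qed.

End TensorMap.

Definition flat (A : comNzRingType) (P : lmodType A) : Prop :=
  forall (M N : lmodType A) (f : {linear M -> N}),
    injective f -> injective (@tensor_mapl A M N P f).

Definition torsion_free (A : idomainType) (M : lmodType A) : Prop :=
  forall (a : A) (x : M), a *: x = 0 -> a = 0 \/ x = 0.

Definition PS_module (A : idomainType) (M : lmodType A) : Prop :=
  torsion_free M /\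
  forall (a b : A) (x y : M),
    a <> 0 -> b <> 0 -> x <> 0 -> y <> 0 -> a *: x = b *: y ->
    exists (c d e : A) (z : M),
      [/\ a = c * e, b = c * d, x = d *: z & y = e *: z].

(* Main.v *)
Require Import Defs.
From HB Require Import structures.
From mathcomp Require Import all_boot all_order all_algebra.
From mathcomp Require Import boolp freeg.

(** If [a u = b v] in [M (x) P], then by flatness [(u, v)] is a sum of elements
    [(x_i (x) p_i, y_i (x) p_i)] with [a x_i = b y_i] in [M].  The equalities
    [a x_i = b y_i] admit a common refinement of [a] and [b]: given a refinement
    [a = c e], [b = c d] for the first ones, refine the next equality in the
    form [e x = d y] and absorb the new common factor of [e] and [d] into [c]. *)

Set Implicit Arguments.
Unset Strict Implicit.
Unset Printing Implicit Defensive.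

Import GRing.Theory.
Local Open Scope ring_scope.

Section LinearImage.
Variables (A : comNzRingType) (N L : lmodType A) (f : {linear N -> L}).

(** The image is built as a module so that [f] factors as a surjection followed by an injection;
    flatness speaks only of the latter. *)
Definition linear_image : {pred L} := fun y => `[< exists x, f x = y >].

Fact linear_image_submod_closed : submod_closed linear_image.
Proof.
split=> [|c _ _ /asboolP[x <-] /asboolP[y <-]]; apply/asboolP.
  by exists 0; rewrite linear0.
by exists (c *: x + y); rewrite linearP.
Qed.

HB.instance Definition _ :=
  GRing.isSubmodClosed.Build A L linear_image linear_image_submod_closed.

Record image_of := ImageOf { image_val : L; _ : image_val \in linear_image }.

HB.instance Definition _ := [isSub for image_val].
HB.instance Definition _ := [Choice of image_of by <:].
HB.instance Definition _ := [SubChoice_isSubLmodule of image_of by <:].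

Fact mem_linear_image x : f x \in linear_image.
Proof. by apply/asboolP; exists x. Qed.

Definition corestrict x : image_of := ImageOf (mem_linear_image x).

Fact corestrict_is_linear : linear corestrict.
Proof. by move=> c x y; apply: val_inj; rewrite /= !linearP. Qed.

HB.instance Definition _ :=
  GRing.isLinear.Build A N image_of _ corestrict corestrict_is_linear.

(** The boolean [==] is what lets [xchoose] pick preimages later. *)
Lemma corestrict_surj (i : image_of) : exists x, corestrict x == i.
Proof.
by case: i => y hy; have /asboolP[x xy] := hy; exists x; apply/eqP/val_inj.
Qed.

End LinearImage.

Lemma tensor_mapl_comp (A : comNzRingType) (N I L P : lmodType A)
    (g : {linear N -> I}) (h : {linear I -> L}) (f : {linear N -> L}) :
  (forall x, h (g x) = f x) ->
  forall w : tensor N P, tensor_mapl h (tensor_mapl g w) = tensor_mapl f w.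
Proof.
move=> hgf; elim/tensor_ind=> [m p||c x y hx hy].
- by rewrite !tensor_mapl_tens hgf.
- by rewrite !linear0.
- by rewrite !linearP /= hx hy.
Qed.

Lemma tensor_mapl_scale (A : comNzRingType) (M P : lmodType A) (c : A)
    (x : tensor M P) :
  tensor_mapl (c \*: idfun : {linear M -> M}) x = c *: x.
Proof.
elim/tensor_ind: x => [m p||k x y hx hy].
- by rewrite tensor_mapl_tens /= linearZl.
- by rewrite !linear0.
- by rewrite !linearP /= hx hy.
Qed.

Section TensorKernel.
(** [Q] plays the role of a submodule; as a predicate it turns the results below into induction
    principles for kernels. *)
Variables (A : comNzRingType) (N P : lmodType A) (Q : tensor N P -> Prop).
Hypothesis Q0 : Q 0.
Hypothesis QP : forall c x y, Q x -> Q y -> Q (c *: x + y).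

Let QD x y : Q x -> Q y -> Q (x + y).
Proof. by move=> hx hy; rewrite -[x]scale1r; apply: QP. Qed.

(* A set-theoretic section of [g] is linear modulo the kernel of [g], hence it
   sends the bilinearity relations into [Q]. *)
Lemma tensor_ker_surj (I : lmodType A) (g : {linear N -> I}) :
  (forall i, exists x, g x == i) ->
  (forall k p, g k = 0 -> Q (tens k p)) ->
  forall w, tensor_mapl g w = 0 -> Q w.
Proof.
move=> gsurj Qk.
pose s i := xchoose (gsurj i).
have gs i : g (s i) = i by apply/eqP/(xchooseP (gsurj i)).
(* As [s] need not be linear, [psi] lives on the free module; by [psi_rel] it descends to the tensor
   product modulo [Q]. *)
pose psi : {linear {freeg (I * P) / A} -> tensor N P} :=
  fglift (fun ip => tens (s ip.1) ip.2).
have psiU i p : psi << (i, p) >> = tens (s i) p by rewrite /= liftU scale1r.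
have psi_rel r : tensor_rel r -> Q (psi r).
  elim=> [m m' p|m p p'|c m p|c m p||c u v _ hu _ hv].
  - rewrite linearB linearD !psiU -linearDl -linearBl.
    by apply: Qk; rewrite linearB linearD !gs subrr.
  - by rewrite linearB linearD !psiU linearDr subrr.
  - rewrite linearB linearZ !psiU /= -linearZl_LR -linearBl.
    by apply: Qk; rewrite linearB linearZ !gs subrr.
  - by rewrite linearB linearZ !psiU linearZr subrr.
  - by rewrite linear0.
  - by rewrite linearP; apply: QP.
have lift w : exists2 r, tensor_pi r = tensor_mapl g w & Q (w - psi r).
  elim/tensor_ind: w => [m p||c x y [r rx hr] [t ty ht]].
  - exists << (g m, p) >>; first by rewrite tensor_mapl_tens.
    by rewrite psiU -linearBl; apply: Qk; rewrite linearB gs subrr.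
  - by exists 0; rewrite !linear0 ?addr0.
  - exists (c *: r + t); first by rewrite !linearP /= rx ty.
    by rewrite linearP opprD addrACA -scalerBr; apply: QP.
(* When [w] maps to 0, its representative [r] is itself a relation, so both [psi r] and [w - psi r]
   satisfy [Q]. *)
move=> w w0; have [r rw hw] := lift w.
rewrite -[w](subrK (psi r)); apply: QD => //; apply: psi_rel.
by rewrite -[r]subr0; apply/tensor_piP; rewrite rw w0 linear0.
Qed.

(** Flatness keeps the inclusion of the image of [f] injective after tensoring, which reduces the
    claim to the surjective case. *)
Lemma flat_tensor_ker (L : lmodType A) (f : {linear N -> L}) :
  flat P -> (forall k p, f k = 0 -> Q (tens k p)) ->
  forall w, tensor_mapl f w = 0 -> Q w.
Proof.
move=> hP Qk w fw0.
apply: (tensor_ker_surj (g := corestrict f)) => [|k p k0|].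
- exact: corestrict_surj.
- by apply: Qk; move/(congr1 val): k0.
- apply: (hP _ _ (val : {linear image_of f -> L}) val_inj).
  by rewrite linear0 (tensor_mapl_comp (f := f)).
Qed.

End TensorKernel.

Lemma torsion_free_scalerI (A : idomainType) (M : lmodType A) (a : A) :
  torsion_free M -> a <> 0 -> injective ( *:%R a : M -> M).
Proof.
move=> tfM a0 x y axy; apply/eqP; rewrite -subr_eq0; apply/eqP.
by case: (tfM a (x - y)) => //; rewrite scalerBr axy subrr.
Qed.

(** For [a] nonzero, scaling by [a] is injective on [M], hence stays injective after tensoring,
    where it is again scaling by [a]. *)
Lemma flat_tensor_torsion_free (A : idomainType) (M P : lmodType A) :
  torsion_free M -> flat P -> torsion_free (tensor M P).
Proof.
move=> tfM hP a x ax0; have [->|/eqP a0] := eqVneq a 0; first by left.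
right; apply: (hP M M (a \*: idfun)); first exact: torsion_free_scalerI.
by rewrite linear0 tensor_mapl_scale.
Qed.

Section Refinement.
Variables (A : idomainType) (a b : A).

(* Every pair proportional to [(a, b)], not only [(a, b)] itself, refines along
   [(u, v)]; it is this strengthening that is stable under addition. *)
Definition refines (U : lmodType A) (u v : U) : Prop :=
  forall e d, e <> 0 -> d <> 0 -> a * d = b * e ->
  exists g e' d' t, [/\ e = g * e', d = g * d', u = d' *: t & v = e' *: t].

Lemma refines0 (U : lmodType A) : refines (0 : U) 0.
Proof. by move=> e d _ _ _; exists 1, e, d, 0; rewrite !mul1r !scaler0. Qed.

Lemma refinesP (U : lmodType A) c (u v u' v' : U) :
  a <> 0 -> refines u v -> refines u' v' ->
  refines (c *: u + u') (c *: v + v').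
Proof.
move=> /eqP a0 huv huv' e d e0 d0 ade.
have [g [e1 [d1 [t [ee dd -> ->]]]]] := huv e d e0 d0 ade.
have g0 : g != 0 by apply/eqP=> g0; apply: e0; rewrite ee g0 mul0r.
have e10 : e1 <> 0 by move=> z; apply: e0; rewrite ee z mulr0.
have d10 : d1 <> 0 by move=> z; apply: d0; rewrite dd z mulr0.
have ade1 : a * d1 = b * e1.
  by apply: (mulfI g0); rewrite mulrCA -dd ade ee mulrCA.
have [g' [e2 [d2 [t' [ee1 dd1 -> ->]]]]] := huv' e1 d1 e10 d10 ade1.
(* Since [d1 = g' * d2] and [e1 = g' * e2], the factor [g'] moves onto [t], leaving [d2] and [e2] as
   common coefficients. *)
exists (g * g'), e2, d2, ((c * g') *: t + t').
rewrite ee dd ee1 dd1 !scalerDr !scalerA !mulrA; split=> //.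
  by rewrite (mulrC d2) mulrAC.
by rewrite (mulrC e2) mulrAC.
Qed.

Lemma PS_refines (M : lmodType A) (x y : M) :
  b <> 0 -> PS_module M -> a *: x = b *: y -> refines x y.
Proof.
move=> b0 [tfM psM] axby e d e0 d0 ade.
(* Both sides agree after scaling by [b], which torsion-freeness cancels. *)
have exdy : e *: x = d *: y.
  apply: (torsion_free_scalerI tfM b0).
  by rewrite !scalerA -ade (mulrC a) (mulrC b) -!scalerA axby.
(* The PS condition needs nonzero vectors; [x] and [y] vanish together, and the zero pair refines
   trivially. *)
have [x0|/eqP x0] := eqVneq x 0.
  have -> : y = 0 by case: (tfM d y) => //; rewrite -exdy x0 scaler0.
  by rewrite x0; apply: refines0 ade.
have y0 : y <> 0.
  by move=> y0; case: (tfM e x) => //; rewrite exdy y0 scaler0.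
have [g [d' [e' [z h]]]] := psM e d x y e0 d0 x0 y0 exdy.
by exists g, e', d', z.
Qed.

End Refinement.

Theorem theorem4p4 (A : idomainType) (M P : lmodType A)
  (hM : PS_module M) (hP : flat P) : PS_module (tensor M P).
Proof.
split=> [|a b u v a0 b0 _ _ aubv].
  exact: flat_tensor_torsion_free hM.1 hP.
pose MM : lmodType A := (M * M)%type.
have lin1 : linear (fun x : M => (x, 0) : MM).
  by move=> c x y; congr pair; rewrite /= scaler0 addr0.
have lin2 : linear (fun x : M => (0, x) : MM).
  by move=> c x y; congr pair; rewrite /= scaler0 addr0.
have linf : linear (fun z : MM => a *: z.1 - b *: z.2).
  move=> c x y /=; rewrite scalerBr !scalerDr !scalerA (mulrC a) (mulrC b).
  by rewrite opprD addrACA.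
pose i1 : {linear M -> MM} :=
  HB.pack (fun x : M => (x, 0) : MM) (GRing.isLinear.Build _ _ _ _ _ lin1).
pose i2 : {linear M -> MM} :=
  HB.pack (fun x : M => (0, x) : MM) (GRing.isLinear.Build _ _ _ _ _ lin2).
pose f : {linear MM -> M} :=
  HB.pack (fun z : MM => a *: z.1 - b *: z.2)
    (GRing.isLinear.Build _ _ _ _ _ linf).
pose p1 : {linear MM -> M} := fst.
pose p2 : {linear MM -> M} := snd.
(* [w] encodes the pair [(u, v)] in the tensor product of [M * M] with [P], where the kernel of [f]
   can be exploited. *)
pose w : tensor MM P := tensor_mapl i1 u + tensor_mapl i2 v.
have mapl_hg (N L : lmodType A) (g : {linear N -> L}) (h : {linear L -> N})
    (c : A) (x : tensor N P) : (forall n, h (g n) = c *: n) ->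
    tensor_mapl h (tensor_mapl g x) = c *: x.
  by move=> hg; rewrite -tensor_mapl_scale; apply: tensor_mapl_comp.
have p1w : tensor_mapl p1 w = u.
  rewrite linearD /= (mapl_hg _ _ _ _ 1) ?(mapl_hg _ _ _ _ 0) => [|n|n] /=.
  - by rewrite scale1r scale0r addr0.
  - by rewrite scale0r.
  - by rewrite scale1r.
have p2w : tensor_mapl p2 w = v.
  rewrite linearD /= (mapl_hg _ _ _ _ 0) ?(mapl_hg _ _ _ _ 1) => [|n|n] /=.
  - by rewrite scale1r scale0r add0r.
  - by rewrite scale1r.
  - by rewrite scale0r.
have fw : tensor_mapl f w = 0.
  rewrite linearD /= (mapl_hg _ _ _ _ a) ?(mapl_hg _ _ _ _ (- b)) => [|n|n] /=.
  - by rewrite scaleNr aubv subrr.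
  - by rewrite scaler0 sub0r scaleNr.
  - by rewrite scaler0 subr0.
pose Q (x : tensor MM P) := refines a b (tensor_mapl p1 x) (tensor_mapl p2 x).
have : Q w.
  apply: (flat_tensor_ker (f := f) _ _ hP) fw; rewrite /Q.
  - by rewrite !linear0; apply: refines0.
  - by move=> c x y hx hy; rewrite !linearP; apply: refinesP.
  - move=> [x y] p /= /eqP; rewrite subr_eq0 => /eqP axby.
    rewrite !tensor_mapl_tens => e d e0 d0 ade.
    (* A refinement of [(x, y)] with vector [t] gives one of the pure tensors with vector
       [tens t p]. *)
    have [g [e' [d' [t [-> -> /= -> ->]]]]] := PS_refines b0 hM axby e0 d0 ade.
    by exists g, e', d', (tens t p); rewrite !linearZl.
(* The pair [(a, b)] is proportional to itself by commutativity. *)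
rewrite /Q p1w p2w => /(_ a b a0 b0 (mulrC a b)).
by move=> [g [e [d [t [ae bd ud ve]]]]]; exists g, d, e, t.
Qed.
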